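(* Let $\Lambda\subset\Gamma$ be Fitting orders over a Fitting domain $\mathfrak{o}$ in an algebra $A$, and let $M$ be a finitely generated $\Lambda$-module. Then $$\mathcal{F}(\Gamma,\Lambda)\cdot\mathrm{Ann}_{\zeta(\Gamma)}(\Gamma\otimes_{\Lambda}M)\subset\mathrm{Ann}_{\zeta(\Lambda)}(M).$$
   Context: Modules are left modules; $\zeta(\cdot)$ denotes the centre of a ring. A Fitting domain is an integrally closed complete commutative noetherian local domain $\mathfrak{o}$; let $F$ be its field of quotients. A Fitting order over $\mathfrak{o}$ is an $\mathfrak{o}$-order in a (finite dimensional) separable $F$-algebra $A$. The central conductor is $\mathcal{F}(\Gamma,\Lambda) := \{x\in\zeta(\Gamma)\mid x\Gamma\subset\Lambda\}$. *)

(* Defs.v *)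
From HB Require Import structures.
From mathcomp Require Import all_boot all_algebra all_field.
From mathcomp Require Import boolp classical_sets.
From mathcomp.multinomials Require Import freeg.

Set Implicit Arguments.
Unset Strict Implicit.
Unset Printing Implicit Defensive.

Import GRing.Theory.

Local Open Scope ring_scope.
Local Open Scope quotient_scope.
Local Open Scope classical_set_scope.

Section CommutativeAlgebra.
Context (R : comNzRingType).
Implicit Types I J m : set R.

Definition is_ideal I : Prop :=
  [/\ I 0, forall x y, I x -> I y -> I (x + y) & forall a x, I x -> I (a * x)].

Definition is_maximal_ideal m : Prop :=
  [/\ is_ideal m, m <> setT
    & forall I, is_ideal I -> m `<=` I -> I = m \/ I = setT].

Definition finitely_generated_ideal I : Prop :=
  exists (n : nat) (g : 'I_n -> R),
    I = [set x | exists c : 'I_n -> R, x = \sum_i c i * g i].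

Definition noetherian : Prop :=
  forall I, is_ideal I -> finitely_generated_ideal I.

Definition unique_maximal_ideal m : Prop :=
  is_maximal_ideal m /\ forall m', is_maximal_ideal m' -> m' = m.

End CommutativeAlgebra.

(* The finite sums of products, for subsets of a possibly noncommutative
   ring. *)
Definition set_mul (R : pzRingType) (I J : set R) : set R :=
  [set x | exists (n : nat) (a b : 'I_n -> R),
     [/\ forall i, I (a i), forall i, J (b i) & x = \sum_i a i * b i]].

Fixpoint ideal_exp (R : pzRingType) (I : set R) (n : nat) : set R :=
  if n is k.+1 then set_mul I (ideal_exp I k) else setT.

(* The canonical map from R to the inverse limit of the R / I ^ n is
   bijective. *)
Definition adic_complete (R : pzRingType) (I : set R) : Prop :=
  (forall x, (forall n, ideal_exp I n x) -> x = 0) /\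
  (forall u : nat -> R,
     (forall n, exists N, forall i j, (N <= i)%N -> (N <= j)%N ->
        ideal_exp I n (u i - u j)) ->
     exists l, forall n, exists N, forall i, (N <= i)%N ->
        ideal_exp I n (u i - l)).

Definition integrally_closed (R : idomainType) : Prop :=
  forall x : {fraction R}, integralOver (@FracField.tofrac R) x -> exists a : R, x = FracField.tofrac a.

Definition complete_local (R : comNzRingType) : Prop :=
  exists m : set R, unique_maximal_ideal m /\ adic_complete m.

Record fitting_domain (o : idomainType) : Prop := FittingDomain {
  fitting_domain_closed : integrally_closed o;
  fitting_domain_noetherian : noetherian o;
  fitting_domain_complete_local : complete_local o
}.

Section SeparableAlgebra.
Context (F : fieldType) (A : falgType F).

Definition left_ideal (U : {vspace A}) : Prop := ({:A} * U <= U)%VS.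

Definition two_sided_ideal (U : {vspace A}) : Prop :=
  ({:A} * U <= U)%VS /\ (U * {:A} <= U)%VS.

Definition semisimple_algebra : Prop :=
  forall U : {vspace A}, left_ideal U ->
  exists V : {vspace A},
    [/\ left_ideal V, (U + V)%VS = {:A}%VS & (U :&: V)%VS = 0%VS].

(* The simple components are the minimal nonzero two-sided ideals; as an
   {aspace A}, such a component carries its own identity element. *)
Definition simple_component (B : {aspace A}) : Prop :=
  two_sided_ideal B /\
  forall U : {vspace A}, two_sided_ideal U -> (U <= B)%VS ->
    U = 0%VS \/ U = B :> {vspace A}.

(* A is semisimple and the centre of each simple component is a separable
   field extension of F: every element of the centre of B is a root, computed
   in the unital F-algebra subvs_of B, of a separable irreducible polynomial. *)
Definition separable_algebra : Prop :=
  semisimple_algebra /\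
  forall B : {aspace A}, simple_component B ->
  forall z : subvs_of B, (forall w, z * w = w * z) ->
  exists p : {poly F},
    [/\ irreducible_poly p, separable_poly p & horner_alg z p = 0].

End SeparableAlgebra.

Section Subring.
Context (A : nzRingType) (L : subringClosed A).

Record subring_of : Type := SubringOf { subring_val : A; _ : subring_val \in L }.

HB.instance Definition _ := [isSub for subring_val].
HB.instance Definition _ := [Choice of subring_of by <:].
HB.instance Definition _ := [SubChoice_isSubNzRing of subring_of by <:].

End Subring.

Section SubringInclusion.
Context (A : nzRingType) (L G : subringClosed A) (LG : {subset L <= G}).

Definition subring_incl (x : subring_of L) : subring_of G :=
  SubringOf (LG (valP x)).

Fact subring_incl_is_zmod_morphism : zmod_morphism subring_incl.
Proof. by move=> x y; apply/val_inj. Qed.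

Fact subring_incl_is_monoid_morphism : monoid_morphism subring_incl.
Proof. by split=> [|x y]; apply/val_inj. Qed.

HB.instance Definition _ := GRing.isZmodMorphism.Build
  (subring_of L) (subring_of G) subring_incl subring_incl_is_zmod_morphism.
HB.instance Definition _ := GRing.isMonoidMorphism.Build
  (subring_of L) (subring_of G) subring_incl subring_incl_is_monoid_morphism.

End SubringInclusion.

(* An o-order in A: a subring with the same identity element that is a
   finitely generated o-submodule of A and spans A over the fraction field. *)
Definition is_order (o : idomainType) (A : falgType {fraction o})
    (L : subringClosed A) : Prop :=
  (exists (n : nat) (b : 'I_n -> A), forall x,
     x \in L <-> exists c : 'I_n -> o, x = \sum_i FracField.tofrac (c i) *: b i) /\
  (exists X : seq A, {subset X <= L} /\ span X = {:A}%VS).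

Definition fitting_order (o : idomainType) (A : falgType {fraction o})
    (L : subringClosed A) : Prop :=
  separable_algebra A /\ is_order L.

Definition finitely_generated_module (R : pzRingType) (M : lmodType R) : Prop :=
  exists (n : nat) (g : 'I_n -> M),
    forall x, exists c : 'I_n -> R, x = \sum_i c i *: g i.

Definition center (R : pzRingType) : set R := [set z | forall y, z * y = y * z].

Definition central_annihilator (R : pzRingType) (M : lmodType R) : set R :=
  [set z | center z /\ forall x : M, z *: x = 0].

Definition central_conductor (A : nzRingType) (G L : subringClosed A) :
    set (subring_of G) :=
  [set x | center x /\ forall g, val (x * g) \in L].

Arguments central_conductor {A} G L _.

(* S (x)_R M for a ring morphism phi : R -> S: the free abelian group on S x M
   modulo the balancing relations, with S acting on the left factor. *)
Section ExtensionOfScalars.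
Context (R S : pzRingType) (phi : {rmorphism R -> S}) (M : lmodType R).

Local Notation free := {freeg (S * M)%type}.
Local Notation gen s m := (<< (s, m) >> : free).

Inductive balanced_relation : free -> Prop :=
| BalancedZero : balanced_relation 0
| BalancedSub u v :
    balanced_relation u -> balanced_relation v -> balanced_relation (u - v)
| BalancedDl s t m : balanced_relation (gen (s + t) m - gen s m - gen t m)
| BalancedDr s m n : balanced_relation (gen s (m + n) - gen s m - gen s n)
| BalancedM s r m : balanced_relation (gen (s * phi r) m - gen s (r *: m)).

Definition balanced_pred : pred free := fun u => `[< balanced_relation u >].

Fact balanced_pred_zmod_closed : zmod_closed balanced_pred.
Proof.
split; first by apply/asboolP; exact: BalancedZero.
by move=> u v /asboolP u0 /asboolP v0; apply/asboolP; exact: BalancedSub.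
Qed.

HB.instance Definition _ :=
  GRing.isZmodClosed.Build free balanced_pred balanced_pred_zmod_closed.

Definition balanced_subgroup : zmodClosed free :=
  GRing.ZmodClosed.clone _ balanced_pred _.

Definition extension : Type := Quotient.quot balanced_subgroup.

HB.instance Definition _ := GRing.Zmodule.on extension.

Definition to_extension (u : free) : extension :=
  \pi_(Quotient.quot balanced_subgroup) u.

Fact to_extension_is_zmod_morphism : zmod_morphism to_extension.
Proof. by move=> u v; rewrite /to_extension raddfB. Qed.

HB.instance Definition _ := GRing.isZmodMorphism.Build free extension
  to_extension to_extension_is_zmod_morphism.

Lemma to_extension_eq u v :
  to_extension u = to_extension v <-> balanced_relation (u - v).
Proof.
have e : (to_extension u == to_extension v) = balanced_pred (u - v).
  by rewrite -[RHS]/(u - v \in balanced_subgroup) Quotient.idealrBE.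
split; first by move/eqP; rewrite e => /asboolP.
by move=> uv; apply/eqP; rewrite e; apply/asboolP.
Qed.

Lemma to_extension_surj (t : extension) : exists u, t = to_extension u.
Proof. by exists (repr t); rewrite /to_extension reprK. Qed.

Definition tensor (s : S) (m : M) : extension := to_extension (gen s m).

Lemma free_additive_ext (N : zmodType) (f g : {additive free -> N}) :
  (forall s m, f (gen s m) = g (gen s m)) -> f =1 g.
Proof.
move=> fg u; rewrite -(freeg_sumE u) !raddf_sum; apply: eq_bigr => -[s m] _.
rewrite -[X in << X *g _ >>]intz -freegU_mulz.
by rewrite !raddfMz fg.
Qed.

Definition extension_act_pre (s : S) : free -> free :=
  fglift (fun x : S * M => gen (s * x.1) x.2).

Lemma extension_act_preU s t m :
  extension_act_pre s (gen t m) = gen (s * t) m.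
Proof. by rewrite /extension_act_pre liftU scale1r. Qed.

HB.instance Definition _ s := GRing.isZmodMorphism.Build free free
  (extension_act_pre s) (lift_is_additive _).

Lemma extension_act_pre_balanced s u :
  balanced_relation u -> balanced_relation (extension_act_pre s u).
Proof.
elim=> [|x y _ hx _ hy|t t' m|t m n|t r m].
- by rewrite raddf0; exact: BalancedZero.
- by rewrite raddfB; exact: BalancedSub.
- by rewrite 2!raddfB /= !extension_act_preU mulrDr; exact: BalancedDl.
- by rewrite 2!raddfB /= !extension_act_preU; exact: BalancedDr.
- by rewrite raddfB /= !extension_act_preU mulrA; exact: BalancedM.
Qed.

Definition extension_act (s : S) (t : extension) : extension :=
  to_extension (extension_act_pre s (repr t)).

Lemma extension_actE s u :
  extension_act s (to_extension u) = to_extension (extension_act_pre s u).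
Proof.
apply/to_extension_eq; rewrite -raddfB; apply: extension_act_pre_balanced.
by apply/to_extension_eq; rewrite /to_extension reprK.
Qed.

Fact extension_actA a b t :
  extension_act a (extension_act b t) = extension_act (a * b) t.
Proof.
have [u ->] := to_extension_surj t; rewrite !extension_actE; congr to_extension.
apply: (free_additive_ext (f := extension_act_pre a \o extension_act_pre b)).
by move=> s m /=; rewrite !extension_act_preU mulrA.
Qed.

Fact extension_act1 : left_id 1 extension_act.
Proof.
move=> t; have [u ->] := to_extension_surj t; rewrite extension_actE.
congr to_extension; apply: (free_additive_ext (g := idfun)).
by move=> s m /=; rewrite extension_act_preU mul1r.
Qed.

Fact extension_actDr : right_distributive extension_act +%R.
Proof.
move=> a t t'; have [u ->] := to_extension_surj t.
have [u' ->] := to_extension_surj t'.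
by rewrite -raddfD !extension_actE !raddfD.
Qed.

Fact extension_actDl t : {morph extension_act^~ t : a b / a + b}.
Proof.
move=> a b /=; have [u ->] := to_extension_surj t; rewrite !extension_actE.
rewrite -raddfD.
apply: (free_additive_ext (f := to_extension \o extension_act_pre (a + b))
  (g := to_extension \o (extension_act_pre a \+ extension_act_pre b))).
move=> s m /=; rewrite !extension_act_preU mulrDl.
by apply/to_extension_eq; rewrite opprD addrA; exact: BalancedDl.
Qed.

HB.instance Definition _ := GRing.Zmodule_isLmodule.Build S extension
  extension_actA extension_act1 extension_actDr extension_actDl.

Lemma scale_tensor a s m : a *: tensor s m = tensor (a * s) m.
Proof.
by rewrite -[LHS]/(extension_act _ _) extension_actE extension_act_preU.
Qed.

Lemma tensorDl s t m : tensor (s + t) m = tensor s m + tensor t m.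
Proof.
by rewrite -raddfD; apply/to_extension_eq; rewrite opprD addrA; exact: BalancedDl.
Qed.

Lemma tensorDr s m n : tensor s (m + n) = tensor s m + tensor s n.
Proof.
by rewrite -raddfD; apply/to_extension_eq; rewrite opprD addrA; exact: BalancedDr.
Qed.

Lemma tensorM s r m : tensor (s * phi r) m = tensor s (r *: m).
Proof. by apply/to_extension_eq; exact: BalancedM. Qed.

Lemma extension_additive_ext (N : zmodType) (f g : {additive extension -> N}) :
  (forall s m, f (tensor s m) = g (tensor s m)) -> f =1 g.
Proof.
move=> fg t; have [u ->] := to_extension_surj t.
exact: (free_additive_ext (f := f \o to_extension) (g := g \o to_extension)).
Qed.

Lemma extension_universal (N : zmodType) (f : S -> M -> N) :
    (forall s t m, f (s + t) m = f s m + f t m) ->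
    (forall s m n, f s (m + n) = f s m + f s n) ->
    (forall s r m, f (s * phi r) m = f s (r *: m)) ->
  exists h : {additive extension -> N}, forall s m, h (tensor s m) = f s m.
Proof.
move=> fDl fDr fM.
pose h0 : free -> N := fglift (M := zmodule N) (fun x => f x.1 x.2).
pose addh0 := GRing.isZmodMorphism.Build free N h0
  (lift_is_additive (M := zmodule N) _).
pose h0' : {additive free -> N} := HB.pack h0 addh0.
have h0U s m : h0' (gen s m) = f s m by rewrite /= /h0 liftU scale1r.
have h0K u : balanced_relation u -> h0' u = 0.
  elim=> [|x y _ hx _ hy|t t' m|t m n|t r m]; first exact: raddf0.
  - by rewrite raddfB hx hy subr0.
  - by rewrite 2!raddfB !h0U fDl addrAC addrK subrr.
  - by rewrite 2!raddfB !h0U fDr addrAC addrK subrr.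
  - by rewrite raddfB !h0U fM subrr.
pose h (t : extension) : N := h0' (repr t).
have hE u : h (to_extension u) = h0' u.
  apply/subr0_eq; rewrite -raddfB; apply: h0K; apply/to_extension_eq.
  by rewrite /to_extension reprK.
have hB : zmod_morphism h.
  move=> t t'; have [u ->] := to_extension_surj t.
  by have [u' ->] := to_extension_surj t'; rewrite -raddfB !hE raddfB.
pose addh := GRing.isZmodMorphism.Build extension N h hB.
pose h' : {additive extension -> N} := HB.pack h addh.
by exists h' => s m; rewrite /= hE.
Qed.

End ExtensionOfScalars.

(* Main.v *)
(* For x in the central conductor, the map g (x) m |-> (x g) m from the extension
   of scalars to M is well defined, since x g lies in Lambda. It sends
   y (x) m = y (1 (x) m) to (x y) m, so x y kills M as soon as y kills the
   extension. *)

Require Import Defs.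
From HB Require Import structures.
From mathcomp Require Import all_boot all_algebra all_field.
From mathcomp Require Import boolp classical_sets.
Import GRing.Theory.
Local Open Scope ring_scope.
Local Open Scope classical_set_scope.

Lemma central_annihilator_sum (R : pzRingType) (M : lmodType R) (n : nat)
    (l : 'I_n -> R) :
  (forall i, central_annihilator M (l i)) ->
  central_annihilator M (\sum_i l i).
Proof.
move=> lM; split=> [y|m].
  by rewrite mulr_suml mulr_sumr; apply: eq_bigr => i _; case: (lM i).
by rewrite scaler_suml big1 // => i _; case: (lM i).
Qed.

(** The product [x * y] lives in [G], but only elements of [L] act on [M]; hence the witness [l]
    with the same value in [A]. *)
Lemma central_conductor_mul {A : nzRingType} {L G : subringClosed A}
    {LG : {subset L <= G}} {M : lmodType (subring_of L)} {x y : subring_of G} :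
  central_conductor G L x ->
  central_annihilator (extension (subring_incl LG) M) y ->
  exists2 l : subring_of L, central_annihilator M l & val l = val (x * y).
Proof.
move=> [xC xL] [yC yM].
pose xmul g : subring_of L := SubringOf (xL g).
have [||s r m|h hE] :=
  @extension_universal _ _ (subring_incl LG) M M (fun g m => xmul g *: m).
- move=> s t m; rewrite -scalerDl; congr (_ *: _).
  by apply: val_inj; rewrite /= mulrDr.
- by move=> s m n; rewrite scalerDr.
(* Balance is associativity in [A]: [x (s r) = (x s) r]. *)
- rewrite scalerA; congr (_ *: _).
  by apply: val_inj; exact: mulrA.
exists (xmul y) => //; split=> [l|m].
  (* Centrality in [G] gives commutation with the image of [L]; injectivity of [val] brings it back
     to [L]. *)
  have xyC : x * y * subring_incl LG l = subring_incl LG l * (x * y).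
    by rewrite -mulrA yC !mulrA xC.
  by apply: val_inj; move/(congr1 val): xyC.
by rewrite -hE -[y]mulr1 -scale_tensor yM raddf0.
Qed.

Theorem proposition6p7 (o : idomainType) (A : falgType {fraction o})
    (Lambda Gamma : subringClosed A) (LG : {subset Lambda <= Gamma})
    (M : lmodType (subring_of Lambda)) :
  fitting_domain o -> fitting_order Lambda -> fitting_order Gamma ->
  finitely_generated_module M ->
  val @` set_mul (central_conductor Gamma Lambda)
           (central_annihilator (extension (subring_incl LG) M))
    `<=` (val @` central_annihilator M : set A).
Proof.
move=> _ _ _ _ _ [_ [n [a [b [aF bM ->]]]] <-].
(* Each product in the finite sum lifts to [Lambda] separately; choosing all the lifts at once lets
   them be summed. *)
have /choice[l lP] i : exists l : subring_of Lambda,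
    central_annihilator M l /\ val l = val (a i * b i).
  by have [l lM lE] := central_conductor_mul (aF i) (bM i); exists l.
exists (\sum_i l i).
  by apply: central_annihilator_sum => i; case: (lP i).
by rewrite !raddf_sum; apply: eq_bigr => i _; case: (lP i).
Qed.
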